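(* Let $X$ be a join space. Then $X$ is projective if and only if $X$ is dense and join-transitive and the pair consisting of $X$ and the set of join-closed subsets of $X$ is a matroid.
   Context: A join space is a set $X$ with a ternary relation $\langle\cdot,\cdot,\cdot\rangle$ on $X$ such that: $\langle a,x,x\rangle$ for all $a,x\in X$; $\langle x,b,y\rangle$ implies $\langle y,b,x\rangle$ for all $x,b,y\in X$; and $\langle x,y,x\rangle$ implies $y=x$ for all $x,y\in X$. For $a,c\in X$ put $ac:=\{x\in X\mid\langle a,x,c\rangle\}$. For $A\subseteq X$ and $x,y\in X$, $\langle A,x,y\rangle$ means that there is $a\in A$ with $\langle a,x,y\rangle$. $X$ is transitive iff for all $a,b,c\in X$, $\langle a,b,c\rangle$ implies $ab\subseteq ac$. $X$ is symmetric iff for all $a,b,c\in X$, $\langle a,b,c\rangle$ and $a\neq b$ imply $\langle a,c,b\rangle$. $X$ is equivalence-relational iff it is transitive and symmetric. $X$ is join-transitive iff for all $a,b\in X$, with $A:=ab$, the binary relation $\langle A,\cdot,\cdot\rangle$ is transitive on $X$. $X$ is preprojective iff it is equivalence-relational and for all $a,b,c,d\in X$: if $b=c$ or $a=d$ or $bc\cap ad\neq\emptyset$, then $a=b$ or $c=d$ or $ab\cap cd\neq\emptyset$. $X$ is dense iff for all $a,b\in X$ with $a\neq b$, $ab\setminus\{a,b\}\neq\emptyset$. $X$ is projective iff it is preprojective and dense. A subset $C\subseteq X$ is join-closed iff $ab\subseteq C$ for all $a,b\in C$. A closure space is a pair $(X,C)$ where $X$ is a set and $C$ is a set of subsets of $X$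 (called closed sets) with $X\in C$ and $\bigcap D\in C$ for every non-empty $D\subseteq C$. For $A\subseteq X$, $\mathrm{cl}(A)$ is the smallest closed superset of $A$, and $\vdash_A$ is the binary relation on $X$ given by $x\vdash_A y:\Leftrightarrow y\in\mathrm{cl}(A\cup\{x\})$. $(X,C)$ is an exchange space iff for each closed $A\subseteq X$ the relation $\vdash_A$ is symmetric on $X\setminus A$. $(X,C)$ is combinatorial iff $\bigcup D\in C$ for each non-empty chain $D\subseteq C$ (with respect to inclusion). A matroid is a combinatorial exchange space (not necessarily finite). *)

(* Defs.v *)
From mathcomp Require Import all_boot classical_sets.
From Corelib Require Relation_Definitions.

Set Implicit Arguments.
Unset Strict Implicit.
Unset Printing Implicit Defensive.

Local Open Scope classical_set_scope.

Record joinSpace := JoinSpace {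
  js_carrier :> Type;
  btw : js_carrier -> js_carrier -> js_carrier -> Prop;
  btw_refl : forall a x, btw a x x;
  btw_sym : forall x b y, btw x b y -> btw y b x;
  btw_eq : forall x y, btw x y x -> y = x }.

Section JoinSpaceTheory.
Variable X : joinSpace.
Implicit Types (a b c d x y : X) (A C : set X).

Definition join a c : set X := [set x | btw a x c].

Definition set_btw A x y : Prop := exists2 a, A a & btw a x y.

Definition js_transitive : Prop :=
  forall a b c, btw a b c -> join a b `<=` join a c.

Definition js_symmetric : Prop :=
  forall a b c, btw a b c -> a <> b -> btw a c b.

Definition equivalence_relational : Prop := js_transitive /\ js_symmetric.

Definition join_transitive : Prop :=
  forall a b, Relation_Definitions.transitive X (set_btw (join a b)).

Definition preprojective : Prop :=
  equivalence_relational /\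
  forall a b c d,
    b = c \/ a = d \/ join b c `&` join a d !=set0 ->
    a = b \/ c = d \/ join a b `&` join c d !=set0.

Definition js_dense : Prop :=
  forall a b, a <> b -> join a b `\` [set a; b] !=set0.

Definition projective : Prop := preprojective /\ js_dense.

Definition join_closed C : Prop :=
  forall a b, C a -> C b -> join a b `<=` C.

End JoinSpaceTheory.

Section ClosureSpaces.
Variables (X : Type) (C : set (set X)).

Definition closure_space : Prop :=
  C [set: X] /\
  forall D : set (set X), D `<=` C -> D !=set0 -> C (\bigcap_(A in D) A).

Definition cl (A : set X) : set X := smallest C A.

Definition entails (A : set X) (x y : X) : Prop := cl (A `|` [set x]) y.

Definition exchange_space : Prop :=
  closure_space /\
  forall A, C A -> forall x y, ~ A x -> ~ A y -> entails A x y -> entails A y x.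

Definition combinatorial : Prop :=
  closure_space /\
  forall D : set (set X), D `<=` C -> D !=set0 -> total_on D subset ->
    C (\bigcup_(A in D) A).

Definition matroid : Prop := combinatorial /\ exchange_space.

End ClosureSpaces.

Arguments js_transitive : clear implicits.
Arguments js_symmetric : clear implicits.
Arguments equivalence_relational : clear implicits.
Arguments join_transitive : clear implicits.
Arguments preprojective : clear implicits.
Arguments js_dense : clear implicits.
Arguments projective : clear implicits.

(* Main.v *)
Require Import Defs.
From mathcomp Require Import all_boot classical_sets.
From mathcomp Require Import boolp.

(** In an equivalence-relational join space the joins [ab] with [a <> b] are
lines, any two distinct points of which determine it, and preprojectivity is
the Veblen-Young axiom.  The latter makes the closure of a nonempty
join-closed [A] together with a point [x] equal to the union of the joins [ax]
for [a] in [A]; since lines are symmetric, exchange follows.  Conversely,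
join-transitivity makes every join [ab] join-closed, so that exchange over the
closed set [{a}] gives symmetry; the Veblen-Young axiom is then transitivity
of the relation induced by [ab], applied to the intersection point of [bc] and [ad]. *)

Set Implicit Arguments.
Unset Strict Implicit.
Unset Printing Implicit Defensive.

Local Open Scope classical_set_scope.

Section JoinSpaceLemmas.
Variable X : joinSpace.
Implicit Types (a b c d e p q r u v w x y z : X) (A C : set X).

Lemma btw_refll x a : btw x x a.
Proof. exact/btw_sym/btw_refl. Qed.

Lemma join_closed_bigcap (D : set (set X)) :
  (forall C, D C -> join_closed C) -> join_closed (\bigcap_(C in D) C).
Proof.
move=> Dcl a b Da Db x abx C DC.
by apply: (Dcl C DC a b) => //; [exact: Da | exact: Db].
Qed.

Lemma join_closed_chain (D : set (set X)) :
  (forall C, D C -> join_closed C) -> total_on D subset ->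
  join_closed (\bigcup_(C in D) C).
Proof.
move=> Dcl Dtot a b [A DA Aa] [B DB Bb] x abx.
have [AB|BA] := Dtot A B DA DB.
- by exists B => //; apply: (Dcl B DB a b) => //; exact: AB.
- by exists A => //; apply: (Dcl A DA a b) => //; exact: BA.
Qed.

Lemma join_closed1 a : join_closed [set a].
Proof. by move=> x y -> -> z /btw_eq. Qed.

Lemma combinatorial_join_closed :
  combinatorial [set C : set X | join_closed C].
Proof.
split; first split => //.
- by move=> D DC _; apply: join_closed_bigcap => C /DC.
- by move=> D DC _ Dtot; apply: join_closed_chain => // C /DC.
Qed.

Section EquivalenceRelational.
Hypotheses (tr : js_transitive X) (sy : js_symmetric X).

(** Unless [a = p], symmetry and transitivity allow [b] to be replaced by [p]: then [q] lies in
    [ap], so [pq] lies in [ap] and hence in [ab]. *)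
Lemma join_closed_join a b : join_closed (join a b).
Proof.
move=> p q abp abq z pzq.
have [ap|ap] := EM (a = p); first by rewrite -ap in pzq; exact: (tr abq pzq).
have aqp : btw a q p by exact: (tr (sy abp ap) abq).
by apply: (tr abp); apply/btw_sym/(tr (btw_sym aqp) pzq).
Qed.

End EquivalenceRelational.

Section Preprojective.
Hypothesis ppX : preprojective X.

Let tr : js_transitive X. Proof. by case: ppX => -[]. Qed.
Let sy : js_symmetric X. Proof. by case: ppX => -[]. Qed.

Lemma veblen_young a b c d e : a <> b -> c <> d ->
  btw b e c -> btw a e d -> exists2 f, btw a f b & btw c f d.
Proof.
move=> ab cd bec aed; have [_ /(_ a b c d)] := ppX.
case=> [|//|[//|[f []]]]; first by right; right; exists e.
by exists f.
Qed.

(** In general position [px] and [qz] meet in [y], so [qp] and [xz] meet in some [r]. It lies in [C]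
    with [p] and [q], and symmetry puts [x] in [rz]. *)
Lemma set_btw_trans C : join_closed C ->
  Relation_Definitions.transitive X (set_btw C).
Proof.
move=> Ccl x y z [p Cp pxy] [q Cq qyz].
have [xp|px] := EM (p = x); first by exists p; rewrite // -xp; exact: btw_refll.
have [xz|xz] := EM (x = z); first by exists p; rewrite // -xz; exact: btw_refl.
have [pq|pq] := EM (p = q).
  by exists p => //; rewrite -pq in qyz; exact: (tr qyz pxy).
have pyx : btw p y x by exact: sy.
have [r qrp xrz] := veblen_young (not_eq_sym pq) xz pyx qyz.
have Cr : C r by exact: (Ccl q p).
(* If [r = z], then [z], [y] and [x] fall into [C] one after another. *)
have [rz|rz] := EM (z = r); last by exists r => //; exact/btw_sym/(sy (btw_sym xrz)).
rewrite -rz in Cr.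
have Cy : C y by exact: (Ccl q z).
by exists x; [exact: (Ccl p y) | exact: btw_refll].
Qed.

Section ConeClosed.
Variables (C : set X) (x : X).
Hypotheses (Ccl : join_closed C) (Cx : ~ C x).

Let cone : set X := [set u | set_btw C u x].

(** The cone consists of the points related to [x] by [set_btw C]; since [v] relates [w] to [u],
    transitivity applies. *)
Let join_cone_base u v : cone u -> C v -> join u v `<=` cone.
Proof.
move=> [c Cc cux] Cv w /btw_sym vwu; rewrite /cone /=.
have vwx : set_btw C w u by exists v.
by apply: (set_btw_trans Ccl vwx); exists c.
Qed.

Lemma join_closed_cone : join_closed [set u | set_btw C u x].
Proof.
move=> u v [c Cc cux] [d Cd dvx] w uwv /=.
have [cd|cd] := EM (c = d).
  rewrite -cd in dvx; exists c => //.
  exact: (join_closed_join tr sy cux dvx uwv).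
have [cv|cv] := EM (c = v).
  by apply: (@join_cone_base u v) => //; [exists c | rewrite -cv].
have [wv|wv] := EM (w = v); first by rewrite wv; exists d.
have [xv|xv] := EM (x = v).
  by exists c => //; rewrite -xv in uwv; exact/btw_sym/(tr (btw_sym cux) (btw_sym uwv)).
have [wx|wx] := EM (w = x); first by exists c => //; rewrite wx; exact: btw_refl.
have vuw : btw v u w by apply: sy; [exact: btw_sym | exact: not_eq_sym].
(* As [vw] and [cx] meet in [u], the joins [cv] and [wx] meet in a point [f], which is in the cone
   by the base case. If [f] differs from [x], then [w] is on the line [xf]. *)
have [f cfv wfx] := veblen_young cv wx vuw cux.
have [e Ce efx] : cone f.
  by apply: (@join_cone_base v c) => //; [exists d | exact: btw_sym].
have [xf|xf] := EM (x = f); last first.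
  exists e => //; apply/btw_sym/(tr (btw_sym efx)).
  by apply: sy => //; exact: btw_sym.
rewrite -xf in cfv.
(* The line [cv] now contains [x] and [d], so [x] would lie in [cd]. *)
have xdv : btw x d v by apply: sy => //; exact: btw_sym.
have cdv : btw c d v by exact/btw_sym/(tr (btw_sym cfv) (btw_sym xdv)).
by case: Cx; apply: (Ccl Cc Cd); exact: (tr (sy cdv cd) cfv).
Qed.

End ConeClosed.

Lemma exchange_join_closed : exchange_space [set C : set X | join_closed C].
Proof.
split; first by case: (combinatorial_join_closed).
move=> C Ccl x y nCx nCy xy.
(* Over an empty [C] the cone is empty and misses [x]; there the closure of [x] is just its
   singleton. *)
have [[c0 Cc0]|C0] := EM (C !=set0); last first.
  have yx : y = x.
    apply: (xy [set x]); split; first exact: join_closed1.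
    by move=> z [Cz|//]; case: C0; exists z.
  by rewrite yx => D [_]; apply; right.
have [c Cc cyx] : set_btw C y x.
  apply: (xy [set u | set_btw C u x]); split; first exact: join_closed_cone.
  move=> z [Cz|->]; first by exists z => //; exact: btw_refll.
  by exists c0 => //; exact: btw_refl.
have cy : c <> y by move=> cy; apply: nCy; rewrite -cy.
move=> D [Dcl DCy]; apply: (Dcl c y); [| |exact: sy].
- by apply: DCy; left.
- by apply: DCy; right.
Qed.

End Preprojective.

Section JoinTransitive.
Hypothesis jtX : join_transitive X.

(** The degenerate join [aa] is the singleton of [a]. *)
Lemma join_transitive_trans : js_transitive X.
Proof.
move=> a b c abc x axb.
have aa : join a a a by exact: btw_refl.
have [p /btw_eq -> //] : set_btw (join a a) x c.
by apply: (jtX (y := b)); exists a.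
Qed.

Lemma join_transitive_join_closed a b : join_closed (join a b).
Proof.
move=> x y axb ayb z xzy.
(* The relation induced by [ab] leads from [z] to [y] through [x], and from [y] to [b] through
   [a]. *)
have [p apb pzb] : set_btw (join a b) z b.
  by apply: (jtX (y := y)); [exists x | exists a => //; exact: btw_refll].
exact/btw_sym/(join_transitive_trans (btw_sym apb) (btw_sym pzb)).
Qed.

Lemma join_transitive_symmetric :
  exchange_space [set C : set X | join_closed C] -> js_symmetric X.
Proof.
move=> [_ exch] a b c abc ab.
have ca : ~ [set a] c by move=> ca; rewrite ca in abc; exact/ab/esym/btw_eq.
have ba : ~ [set a] b by move=> ba; exact/ab/esym.
have cb : entails [set C : set X | join_closed C] [set a] c b.
  by move=> D [Dcl Dac]; apply: (Dcl a c) => //; apply: Dac; [left | right].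
apply: (exch _ (@join_closed1 a) _ _ ca ba cb (join a b)); split.
  exact: join_transitive_join_closed.
by move=> x [->|->]; [exact: btw_refll | exact: btw_refl].
Qed.

Lemma join_transitive_preprojective : js_symmetric X -> preprojective X.
Proof.
move=> sy; split; first by split=> //; exact: join_transitive_trans.
move=> a b c d H.
have [->|ab] := EM (a = b); first by left.
have [->|cd] := EM (c = d); first by right; left.
right; right; case: H => [<-|[<-|[e [bec aed]]]].
- by exists b; split; [exact: btw_refl | exact: btw_refll].
- by exists a; split; [exact: btw_refll | exact: btw_refl].
(* If [e = b], symmetry puts [d] itself on [ab]. *)
have [be|be] := EM (b = e).
  have bd : btw a d b by apply: sy => //; rewrite be.
  by exists d; split => //; exact: btw_refl.
(* The chain runs from [c] to [e] through [b], then from [e] to [d] through [a]. *)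
have [r arb rcd] : set_btw (join a b) c d.
  by apply: (jtX (y := e)); [exists b; [exact: btw_refl | exact: sy]
                            | exists a => //; exact: btw_refll].
exists r; split => //; apply/btw_sym/sy; first exact: btw_sym.
exact: not_eq_sym.
Qed.

End JoinTransitive.
End JoinSpaceLemmas.

Theorem corollary6p5 (X : joinSpace) :
  projective X <->
  js_dense X /\ join_transitive X /\
  matroid [set C : set X | join_closed C]%classic.
Proof.
split=> [[pp dense]|[dense [jt [_ exch]]]].
  split => //; split.
    move=> a b; apply: (set_btw_trans pp).
    by have [[tr sy] _] := pp; exact: join_closed_join.
  by split; [exact: combinatorial_join_closed | exact: exchange_join_closed].
split=> //; apply: (join_transitive_preprojective jt).
exact: join_transitive_symmetric.
Qed.
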